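(* Let $n\ge 2$, let $I\subseteq\mathbb{R}$ be a non-degenerate interval and let $f_1,\dots,f_n:I\to\mathbb{R}$ be continuous strictly increasing functions. Then the Gauss composition of the means $A^{\langle 0\rangle}_{f_1,\dots,f_n},\dots,A^{\langle n-1\rangle}_{f_1,\dots,f_n}$ is the $n$-variable quasi-arithmetic mean $A_{f_1+\dots+f_n}$, that is, $$\Gamma\big(A^{\langle 0\rangle}_{f_1,\dots,f_n},\dots,A^{\langle n-1\rangle}_{f_1,\dots,f_n}\big)=A_{f_1+\dots+f_n}\quad\text{on } I^n.$$ Furthermore, for all $x_{i,j}\in I$ ($i,j\in\{1,\dots,n\}$), the generalized bisymmetry equation $$A_{f_1+\dots+f_n}\big(A^{\langle 0\rangle}_{f_1,\dots,f_n}(x_{1,1},\dots,x_{n,1}),\dots,A^{\langle n-1\rangle}_{f_1,\dots,f_n}(x_{1,n},\dots,x_{n,n})\big)=A_{f_1+\dots+f_n}\big(A^{\langle 0\rangle}_{f_1,\dots,f_n}(x_{1,1},\dots,x_{1,n}),\dots,A^{\langle n-1\rangle}_{f_1,\dots,f_n}(x_{n,1},\dots,x_{n,n})\big)$$ holds. (On the left-hand side the $j$th argument is $A^{\langle j-1\rangle}_{f_1,\dots,f_n}(x_{1,j},\dots,x_{n,j})$; on the right-hand side the $i$th argument is $A^{\langle i-1\rangle}_{f_1,\dots,f_n}(x_{i,1},\dots,x_{i,n})$.)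
   Context: Let $I\subseteq\mathbb{R}$ be a non-degenerate interval. Means: a function $M:I^n\to I$ is an ($n$-variable) mean if $\min(x_1,\dots,x_n)\le M(x_1,\dots,x_n)\le\max(x_1,\dots,x_n)$ for all $x_1,\dots,x_n\in I$; it is a strict mean if both inequalities are strict whenever $\min(x_1,\dots,x_n)<\max(x_1,\dots,x_n)$. Quasi-arithmetic mean: for a continuous strictly monotone $f:I\to\mathbb{R}$, the $n$-variable quasi-arithmetic mean generated by $f$ is $A_f(x_1,\dots,x_n):=f^{-1}\big(\tfrac{f(x_1)+\cdots+f(x_n)}{n}\big)$. In particular $A_{f_1+\dots+f_n}$ denotes the $n$-variable quasi-arithmetic mean generated by the single function $f_1+\dots+f_n$. Generalized quasi-arithmetic mean: for continuous strictly increasing $f_1,\dots,f_n:I\to\mathbb{R}$, $A_{f_1,\dots,f_n}(x_1,\dots,x_n):=(f_1+\cdots+f_n)^{-1}(f_1(x_1)+\cdots+f_n(x_n))$ for $x_1,\dots,x_n\in I$. These are continuous strict means. Cyclic permutation: $\sigma:\{1,\dots,n\}\to\{1,\dots,n\}$, $\sigma(1)=n$ and $\sigma(k)=k-1$ for $k\in\{2,\dots,n\}$. For an $n$-variable mean $M:I^n\to I$ and $i\in\mathbb{Z}$, $M^{\langle i\rangle}(x_1,\dots,x_n):=M(x_{\sigma^i(1)},\dots,x_{\sigma^i(n)})$. Gauss composition: if $M_1,\dots,M_n:I^n\to I$ are continuous strict means, it is known that there is a unique continuous strict mean $K:I^n\to I$ such that the iterates $(M_1,\dots,M_n)^k$ of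 the map $(M_1,\dots,M_n):I^n\to I^n$ converge pointwise to $(K,\dots,K)$ as $k\to\infty$; moreover $K$ is the unique mean satisfying $K\circ(M_1,\dots,M_n)=K$. This $K$ is called the Gauss composition of $M_1,\dots,M_n$ and is denoted $\Gamma(M_1,\dots,M_n)$. *)

(* Defs.v *)
From mathcomp Require Import all_boot all_order all_algebra.
From mathcomp Require Import all_classical all_reals all_analysis.

Set Implicit Arguments.
Unset Strict Implicit.
Unset Printing Implicit Defensive.

Import Order.TTheory GRing.Theory Num.Theory.
Import numFieldNormedType.Exports.

Local Open Scope classical_set_scope.
Local Open Scope ring_scope.

(* Points of R^(n+1) are row vectors, indexed from 0.  A function I^(n+1) -> I
   is a total function on row vectors; only its values on [cube I] = I^(n+1) matter. *)

Definition cube {R : realType} {n : nat} (I : set R) : set 'rV[R]_n.+1 :=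
  [set x | forall i, I (x ord0 i)].

Definition min_row {R : realType} {n : nat} (x : 'rV[R]_n.+1) : R :=
  \big[Num.min/x ord0 ord0]_i x ord0 i.

Definition max_row {R : realType} {n : nat} (x : 'rV[R]_n.+1) : R :=
  \big[Num.max/x ord0 ord0]_i x ord0 i.

Definition is_mean {R : realType} {n : nat} (I : set R)
    (M : 'rV[R]_n.+1 -> R) : Prop :=
  forall x, cube I x -> I (M x) /\ min_row x <= M x <= max_row x.

Definition is_strict_mean {R : realType} {n : nat} (I : set R)
    (M : 'rV[R]_n.+1 -> R) : Prop :=
  is_mean I M /\
  forall x, cube I x -> min_row x < max_row x ->
    min_row x < M x < max_row x.

Definition continuous_strict_mean {R : realType} {n : nat} (I : set R)
    (M : 'rV[R]_n.+1 -> R) : Prop :=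
  {within cube I, continuous M} /\ is_strict_mean I M.

(* [g] is meant to be injective on [I]; [inv_on I g] is its inverse
   g(I) -> I, with the junk value 0 outside g(I). *)
Definition inv_on {R : realType} (I : set R) (g : R -> R) : R -> R :=
  'pinv_(fun=> 0) I g.

Definition qa_mean {R : realType} {n : nat} (I : set R) (g : R -> R)
    (x : 'rV[R]_n.+1) : R :=
  inv_on I g ((\sum_i g (x ord0 i)) / n.+1%:R).

Definition fun_sum {R : realType} {n : nat} (f : 'I_n.+1 -> R -> R) : R -> R :=
  fun t => \sum_i f i t.

Definition gqa_mean {R : realType} {n : nat} (I : set R)
    (f : 'I_n.+1 -> R -> R) (x : 'rV[R]_n.+1) : R :=
  inv_on I (fun_sum f) (\sum_i f i (x ord0 i)).

(* M^<i>, the cyclic permutation being [ord_pred]: 0 |-> n, k+1 |-> k. *)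
Definition cyc_mean {R : realType} {n : nat} (M : 'rV[R]_n.+1 -> R) (i : nat)
    (x : 'rV[R]_n.+1) : R :=
  M (\row_k x ord0 (iter i (@ord_pred n.+1) k)).

Definition mean_map {R : realType} {n : nat}
    (M : 'I_n.+1 -> 'rV[R]_n.+1 -> R) (x : 'rV[R]_n.+1) : 'rV[R]_n.+1 :=
  \row_i M i x.

Definition is_gauss_composition {R : realType} {n : nat} (I : set R)
    (M : 'I_n.+1 -> 'rV[R]_n.+1 -> R) (K : 'rV[R]_n.+1 -> R) : Prop :=
  [/\ forall i, continuous_strict_mean I (M i),
      continuous_strict_mean I K
    & forall x, cube I x ->
        iter k (mean_map M) x @[k --> \oo] --> (const_mx (K x) : 'rV[R]_n.+1)].

(* The Gauss composition exists and is unique on [cube I] when the M_i are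
   continuous strict means; the zero function is returned if none exists. *)
Definition gauss_composition {R : realType} {n : nat} (I : set R)
    (M : 'I_n.+1 -> 'rV[R]_n.+1 -> R) : 'rV[R]_n.+1 -> R :=
  xget (fun=> 0) [set K | is_gauss_composition I M K].

(* Main.v *)
Require Import Defs.
From mathcomp Require Import all_boot all_order all_algebra.
From mathcomp Require Import all_classical all_reals all_analysis.

Set Implicit Arguments.
Unset Strict Implicit.
Unset Printing Implicit Defensive.

Import Order.TTheory GRing.Theory Num.Theory.
Import numFieldNormedType.Exports.

Local Open Scope classical_set_scope.
Local Open Scope ring_scope.

(** Write F for the sum of the generators [f k]. The mean of index [i] applied
    to [x] is the point whose value under F is the sum of the [f k] at the
    entries of [x] rotated by [i]. Permuting the generators instead of the
    entries, it is the generalized quasi-arithmetic mean with generators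
    [h i j = f (j + i)], indices being taken in the cyclic group
    ([cyc_mean_gqa]). What makes the theorem true is that every row and every
    column of the array [h] sums to F. The rows give all the means the same
    outer function F. The columns show that adding up the values of F at the
    means of [x] restores the sum of the values of F at the entries of [x]:
    the quasi-arithmetic mean generated by F is invariant under the mean map
    ([qa_mean_invariant]).

    Along the iterates of the mean map the least entry increases and the
    greatest decreases, with the invariant value in between, so only the closing
    of the gap has to be shown. If the least entries stayed below some [s] and
    the greatest above some [t > s], then in each mean some generator would see
    an entry at least [t], and F at the least entry would grow at each step by
    at least the smallest of the increments [h i j t - h i j s]
    ([gqa_mean_gain], [iter_mean_map_gap]). This is impossible since it stays
    below F at [s].

    That the means are continuous and strict is proved once, for [gqa_mean]
    ([gqa_mean_csm]); the quasi-arithmetic mean is covered by taking all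
    generators equal to F divided by the number of variables ([qa_mean_gqa]).

    For the bisymmetry equation, either side is obtained from F and the average
    of the [h i j] at the entries [X i j]: the right side sums along the rows,
    the left side along the columns, and [h] is symmetric
    ([constant_sums_bisymmetry]). *)

Lemma ltr_sum_exists {R : numDomainType} {T : finType} (u v : T -> R) (j : T) :
  (forall i, u i <= v i) -> u j < v j -> \sum_i u i < \sum_i v i.
Proof.
move=> uv uvj; rewrite (bigD1 j)//= [ltRHS](bigD1 j)//=.
by apply: ltr_leD => //; apply: ler_sum => i _.
Qed.

(** * Rows and their extreme entries *)

Section Rows.
Context {R : realType} {n : nat}.
Implicit Types x : 'rV[R]_n.+1.

Lemma min_row_le x i : min_row x <= x ord0 i.
Proof. exact: bigmin_le. Qed.

Lemma le_max_row x i : x ord0 i <= max_row x.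
Proof. exact: le_bigmax. Qed.

Lemma min_row_attained x : exists i, min_row x = x ord0 i.
Proof.
rewrite /min_row; elim/big_ind: _; [by exists ord0| |by move=> i _; exists i].
by move=> a b [i ->] [j ->]; case: leP => _; [exists i | exists j].
Qed.

Lemma max_row_attained x : exists i, max_row x = x ord0 i.
Proof.
rewrite /max_row; elim/big_ind: _; [by exists ord0| |by move=> i _; exists i].
by move=> a b [i ->] [j ->]; case: leP => _; [exists j | exists i].
Qed.

Lemma min_row_le_max_row x : min_row x <= max_row x.
Proof. exact: le_trans (min_row_le x ord0) (le_max_row x ord0). Qed.

Lemma min_row_in (I : set R) x : cube I x -> I (min_row x).
Proof. by move=> Ix; have [i ->] := min_row_attained x. Qed.

Lemma max_row_in (I : set R) x : cube I x -> I (max_row x).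
Proof. by move=> Ix; have [i ->] := max_row_attained x. Qed.

Lemma cvg_coord_within (I : set R) (i : 'I_n.+1) x :
  y ord0 i @[y --> within (@cube R n I) (nbhs x)] -->
    within I (nbhs (x ord0 i)).
Proof.
move=> P IP.
have : \forall y \near x, I ((y : 'rV[R]_n.+1) ord0 i) -> P (y ord0 i).
  exact: (@coord_continuous R 1 n.+1 ord0 i x _ IP).
by apply: filterS => y yP Iy; exact: yP.
Qed.

End Rows.

(** * Generalized quasi-arithmetic means are continuous strict means *)

Section GeneralizedMean.
Context {R : realType} {n : nat} (I : set R) (h : 'I_n.+1 -> R -> R).
Hypothesis I_itv : is_interval I.
Hypothesis h_cont : forall i, {within I, continuous (h i)}.
Hypothesis h_incr : forall i (s t : R), I s -> I t -> s < t -> h i s < h i t.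

Lemma nondecr_on i s t : I s -> I t -> s <= t -> h i s <= h i t.
Proof.
move=> Is It; rewrite le_eqVlt => /predU1P[->//|st].
exact/ltW/h_incr.
Qed.

Lemma fun_sum_incr s t : I s -> I t -> s < t -> fun_sum h s < fun_sum h t.
Proof.
by move=> Is It st; apply: (ltr_sum_exists (j := ord0)) => [i|];
  [exact/nondecr_on/ltW | exact: h_incr].
Qed.

Lemma fun_sum_le s t : I s -> I t -> (fun_sum h s <= fun_sum h t) = (s <= t).
Proof.
move=> Is It; apply/idP/idP => [|st]; last first.
  by apply: ler_sum => i _; exact: nondecr_on.
by apply: contraTT; rewrite -!ltNge; exact: fun_sum_incr.
Qed.

Lemma fun_sum_lt s t : I s -> I t -> (fun_sum h s < fun_sum h t) = (s < t).
Proof. by move=> Is It; rewrite !ltNge fun_sum_le. Qed.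

Lemma fun_sum_inj s t : I s -> I t -> fun_sum h s = fun_sum h t -> s = t.
Proof.
move=> Is It st; apply/le_anti.
by rewrite -(fun_sum_le Is It) -(fun_sum_le It Is) st lexx.
Qed.

Lemma fun_sum_continuous : {within I, continuous (fun_sum h)}.
Proof.
apply/subspace_continuousP => s Is.
apply: cvg_big => [|i _]; first exact: add_continuous.
by have /subspace_continuousP := @h_cont i; exact.
Qed.

(** The sum lies between the values of [fun_sum h] at the least and the
    greatest entry, so the intermediate value theorem puts it in the image
    of [I]: the junk value of [inv_on] never occurs. *)
Lemma gqa_meanP x : cube I x ->
  I (gqa_mean I h x) /\ fun_sum h (gqa_mean I h x) = \sum_i h i (x ord0 i).
Proof.
move=> Ix; have Imin := min_row_in Ix; have Imax := max_row_in Ix.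
have mm := min_row_le_max_row x.
have sub : `[min_row x, max_row x]%classic `<=` I.
  by move=> t /=; rewrite in_itv/= => tx; exact: (I_itv Imin Imax).
have Fmm : fun_sum h (min_row x) <= fun_sum h (max_row x) by rewrite fun_sum_le.
have [||c cx cE] := @IVT R (fun_sum h) _ _ (\sum_i h i (x ord0 i)) mm.
- exact: continuous_subspaceW fun_sum_continuous.
- rewrite min_l// max_r//; apply/andP; split; apply: ler_sum => i _;
    apply: nondecr_on => //; [exact: min_row_le | exact: le_max_row].
have Ic : I c by exact: sub.
rewrite /gqa_mean /inv_on -cE pinvKV ?inE//.
by move=> s t; rewrite !inE; exact: fun_sum_inj.
Qed.

Lemma gqa_mean_is_mean : is_mean I (gqa_mean I h).
Proof.
move=> x Ix; have [IA AE] := gqa_meanP Ix; split=> //.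
have Imin := min_row_in Ix; have Imax := max_row_in Ix.
rewrite -fun_sum_le// -[X in _ && X]fun_sum_le// AE.
apply/andP; split; apply: ler_sum => i _; apply: nondecr_on => //;
  [exact: min_row_le | exact: le_max_row].
Qed.

(** An entry at least [t] keeps the mean away from the minimum by an amount
    that, measured through [fun_sum h], depends only on [j],
    [s] and [t]. *)
Lemma gqa_mean_gain x s t j : cube I x -> I s -> I t ->
  min_row x <= s -> t <= x ord0 j ->
  fun_sum h (min_row x) + (h j t - h j s) <= fun_sum h (gqa_mean I h x).
Proof.
move=> Ix Is It xs tx; have [_ ->] := gqa_meanP Ix.
have Imin := min_row_in Ix.
rewrite /fun_sum (bigD1 j)//= [leRHS](bigD1 j)//= addrAC lerD//.
  have hxs := nondecr_on j Imin Is xs; have htx := nondecr_on j It (Ix j) tx.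
  by rewrite addrCA -[leRHS]addr0 lerD// subr_le0.
by apply: ler_sum => i _; apply: nondecr_on => //; exact: min_row_le.
Qed.

(** Inverting an increasing function on an interval creates no discontinuity:
    for [c] the mean at [x], a point of [I] slightly above [c] bounds the mean
    near [x] because the sum of the generators is continuous; if [I] has no
    point just above [c], then [c] is the right end of [I] and bounds the mean
    everywhere. The lower bound is symmetric. *)
Lemma gqa_mean_continuous : {within cube I, continuous (gqa_mean I h)}.
Proof.
apply/subspace_continuousP => x Ix; have [Ic cE] := gqa_meanP Ix.
set c := gqa_mean I h x in Ic cE *.
have Scont : \sum_i h i (y ord0 i) @[y --> within (@cube R n I) (nbhs x)]
    --> fun_sum h c.
  rewrite cE; apply: cvg_big => [|i _]; first exact: add_continuous.
  have hx : h i t @[t --> within I (nbhs (x ord0 i))] --> h i (x ord0 i).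
    by have /subspace_continuousP := @h_cont i; exact.
  exact: cvg_comp _ _ (cvg_coord_within (I := I) (i := i) (x := x)) hx.
apply/cvgrPdist_lt => e e0.
have above : \forall y \near within (@cube R n I) (nbhs x),
    gqa_mean I h y < c + e.
  have [[t [It ct te]]|noI] := pselect (exists t, [/\ I t, c < t & t < c + e]).
    have : \forall y \near within (@cube R n I) (nbhs x),
        \sum_i h i ((y : 'rV[R]_n.+1) ord0 i) < fun_sum h t.
      by apply: (cvgr_lt _ Scont); exact: fun_sum_incr.
    apply: filterS2 (withinT _ _) => y Iy; have [IA <-] := gqa_meanP Iy.
    by rewrite fun_sum_lt// => /lt_trans; exact.
  apply: filterS (withinT _ _) => y Iy; have [IA _] := gqa_meanP Iy.
  rewrite ltNge; apply/negP => ceA; apply: noI; exists (c + e / 2).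
  have e2 : 0 < e / 2 < e by rewrite divr_gt0//= gtr_pMr// invf_lt1// ltr1n.
  have [e2_gt0 e2_lt] := andP e2.
  split; [|by rewrite ltrDl|by rewrite ltrD2l].
  apply: (I_itv Ic IA); rewrite lerDl ltW//= ltW//.
  by apply: lt_le_trans ceA; rewrite ltrD2l.
have below : \forall y \near within (@cube R n I) (nbhs x),
    c - e < gqa_mean I h y.
  have [[t [It ct te]]|noI] := pselect (exists t, [/\ I t, c - e < t & t < c]).
    have : \forall y \near within (@cube R n I) (nbhs x),
        fun_sum h t < \sum_i h i ((y : 'rV[R]_n.+1) ord0 i).
      by apply: (cvgr_gt _ Scont); exact: fun_sum_incr.
    apply: filterS2 (withinT _ _) => y Iy; have [IA <-] := gqa_meanP Iy.
    by rewrite fun_sum_lt//; exact: lt_trans.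
  apply: filterS (withinT _ _) => y Iy; have [IA _] := gqa_meanP Iy.
  rewrite ltNge; apply/negP => ceA; apply: noI; exists (c - e / 2).
  have e2 : 0 < e / 2 < e by rewrite divr_gt0//= gtr_pMr// invf_lt1// ltr1n.
  have [e2_gt0 e2_lt] := andP e2.
  have cee : c - e < c - e / 2 by rewrite ltrD2l ltrN2.
  split; [|by []|by rewrite gtrBl].
  apply: (I_itv IA Ic); rewrite gerBl (ltW e2_gt0) andbT ltW//.
  exact: le_lt_trans ceA cee.
by apply: filterS2 above below => y ya yb; rewrite distrC ltr_distl yb.
Qed.

Lemma gqa_mean_csm : continuous_strict_mean I (gqa_mean I h).
Proof.
split; first exact: gqa_mean_continuous.
split=> [|x Ix mm]; first exact: gqa_mean_is_mean.
have [IA AE] := gqa_meanP Ix.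
have Imin := min_row_in Ix; have Imax := max_row_in Ix.
rewrite -fun_sum_lt// -[X in _ && X]fun_sum_lt// AE; apply/andP; split.
  have [j xj] := max_row_attained x.
  apply: (ltr_sum_exists (j := j)) => [i|]; last by rewrite -xj; exact: h_incr.
  exact/nondecr_on/min_row_le.
have [j xj] := min_row_attained x.
apply: (ltr_sum_exists (j := j)) => [i|]; last by rewrite -xj; exact: h_incr.
exact/nondecr_on/le_max_row.
Qed.

End GeneralizedMean.

(** The division by the number of variables is absorbed in the generators, so
    that their sum is [g] again; results on [gqa_mean] then cover [qa_mean]. *)
Lemma qa_mean_gqa {R : realType} {n : nat} (I : set R) (g : R -> R) :
  @qa_mean R n I g = gqa_mean I (fun _ t => g t / n.+1%:R).
Proof.
apply/funext => x; rewrite /qa_mean /gqa_mean mulr_suml; congr (inv_on I _ _).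
apply/funext => t; rewrite /fun_sum sumr_const card_ord -[RHS]mulr_natr.
by rewrite divfK// pnatr_eq0.
Qed.

(** * Arrays of generators with constant row and column sums *)

Section ConstantSums.
Context {R : realType} {n : nat} (I : set R).
Context (h : 'I_n.+1 -> 'I_n.+1 -> R -> R) (F : R -> R).
Hypothesis I_itv : is_interval I.
Hypothesis h_cont : forall i j, {within I, continuous (h i j)}.
Hypothesis h_incr :
  forall i j (s t : R), I s -> I t -> s < t -> h i j s < h i j t.
Hypothesis row_sum : forall i, fun_sum (h i) = F.
Hypothesis col_sum : forall j, fun_sum (h^~ j) = F.

Let A i : 'rV[R]_n.+1 -> R := gqa_mean I (h i).
Let AF : 'rV[R]_n.+1 -> R := qa_mean I F.

Let A_csm i : continuous_strict_mean I (A i).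
Proof. by apply: gqa_mean_csm => // j; exact: h_incr. Qed.

Lemma qa_mean_csm : continuous_strict_mean I AF.
Proof.
rewrite /AF qa_mean_gqa; apply: gqa_mean_csm => // [_|_ s t Is It st].
  have Fc : {within I, continuous F}.
    by rewrite -(row_sum ord0); exact: fun_sum_continuous.
  apply/subspace_continuousP => s Is; apply: cvgMl.
  by move/subspace_continuousP: Fc; exact.
by rewrite ltr_pM2r ?invr_gt0// -(row_sum ord0) (fun_sum_incr (@h_incr ord0)).
Qed.

Let F_le s t : I s -> I t -> (F s <= F t) = (s <= t).
Proof. by move=> Is It; rewrite -(row_sum ord0) (fun_sum_le (@h_incr ord0)). Qed.

Lemma generator_gqa_mean i x : cube I x -> F (A i x) = \sum_j h i j (x ord0 j).
Proof.
by move=> Ix; have [_ <-] := gqa_meanP I_itv (@h_cont i) (@h_incr i) Ix;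
  rewrite row_sum.
Qed.

Lemma mean_map_cube x : cube I x -> cube I (mean_map A x).
Proof. by move=> Ix i; rewrite mxE; have [_ [+ _]] := A_csm i => /(_ _ Ix)[]. Qed.

(** Summing the values of [F] at all the means and exchanging the sums brings
    in the column sums, which recover [F] at each entry of [x]. *)
Lemma qa_mean_invariant x : cube I x -> AF (mean_map A x) = AF x.
Proof.
move=> Ix; rewrite /AF /qa_mean; congr (inv_on I _ (_ / _)).
under eq_bigr do rewrite mxE generator_gqa_mean//.
by rewrite exchange_big; apply: eq_bigr => j _; rewrite -(col_sum j).
Qed.

Lemma iter_mean_map_cube k x : cube I x -> cube I (iter k (mean_map A) x).
Proof. by move=> Ix; elim: k => //= k; exact: mean_map_cube. Qed.

Lemma iter_mean_map_qa_mean k x : cube I x ->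
  AF (iter k (mean_map A) x) = AF x.
Proof.
move=> Ix; elim: k => //= k IHk; rewrite qa_mean_invariant//.
exact: iter_mean_map_cube.
Qed.

Lemma min_row_mean_map x : cube I x -> min_row x <= min_row (mean_map A x).
Proof.
move=> Ix; have [i ->] := min_row_attained (mean_map A x); rewrite mxE.
by have [_ [/(_ _ Ix)[_ /andP[]]]] := A_csm i.
Qed.

Lemma max_row_mean_map x : cube I x -> max_row (mean_map A x) <= max_row x.
Proof.
move=> Ix; have [i ->] := max_row_attained (mean_map A x); rewrite mxE.
by have [_ [/(_ _ Ix)[_ /andP[]]]] := A_csm i.
Qed.

(** If the gap never closed, the minima would stay below [s] and the maxima
    above [t]; every mean would then exceed the current minimum by a fixed
    positive amount, measured through [F], although [F] is bounded by [F s]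
    along the minima. *)
Lemma iter_mean_map_gap x s t : cube I x -> I s -> I t -> s < t ->
  ~ forall k, min_row (iter k (mean_map A) x) <= s /\
              t <= max_row (iter k (mean_map A) x).
Proof.
move=> Ix Is It st gap; set y := fun k => iter k (mean_map A) x.
have Iy k : cube I (y k) by exact: iter_mean_map_cube.
have [d d0 dh] : exists2 d, 0 < d & forall i j, d <= h i j t - h i j s.
  (* All the increments are positive; the default value 1 only has to be so. *)
  exists (\big[Num.min/1]_p (h p.1 p.2 t - h p.1 p.2 s)).
    by apply/bigmin_gtP; split=> // p _; rewrite subr_gt0; exact: h_incr.
  by move=> i j; exact: (@bigmin_inf _ _ _ _ (i, j)).
have step k : F (min_row (y k)) + d <= F (min_row (y k.+1)).
  have [i ->] := min_row_attained (y k.+1); rewrite /= mxE.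
  have [j yj] := max_row_attained (y k); have [ys] := gap k.
  rewrite -/(y k) yj => ty.
  rewrite -(row_sum i); apply: le_trans (gqa_mean_gain I_itv (@h_cont i)
    (@h_incr i) (Iy k) Is It ys ty).
  by rewrite lerD2l.
have steps k : F (min_row x) + d *+ k <= F (min_row (y k)).
  elim: k => [|k IHk]; first by rewrite addr0.
  by rewrite mulrSr addrA; apply: le_trans (step k); rewrite lerD2r.
have bounded k : d *+ k <= F s - F (min_row x).
  rewrite lerBrDl; apply: le_trans (steps k) _.
  by rewrite F_le//; [have [] := gap k | exact: min_row_in].
have := bounded (Num.bound ((F s - F (min_row x)) / d)).
apply/negP; rewrite -ltNge -mulr_natr mulrC -ltr_pdivrMr//.
by apply: archi_boundP; rewrite divr_ge0 ?(ltW d0)//; exact: (bounded 0%N).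
Qed.

(** The minima of the iterates increase, the maxima decrease, and the invariant
    value [AF x] always lies between them. If the two limits differed, they
    would serve as [s] and [t] in [iter_mean_map_gap]; so both equal [AF x] and
    squeeze every coordinate. *)
Lemma iter_mean_map_cvg x : cube I x ->
  iter k (mean_map A) x @[k --> \oo] --> (const_mx (AF x) : 'rV[R]_n.+1).
Proof.
move=> Ix; set y := fun k => iter k (mean_map A) x.
have Iy k : cube I (y k) by exact: iter_mean_map_cube.
pose a k := min_row (y k); pose b k := max_row (y k).
have a_nd : nondecreasing_seq a.
  by apply/nondecreasing_seqP => k; exact: min_row_mean_map.
have b_ni : nonincreasing_seq b.
  by apply/nonincreasing_seqP => k; exact: max_row_mean_map.
have aAF k : a k <= AF x.
  rewrite -(iter_mean_map_qa_mean k Ix).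
  by have [_ [/(_ _ (Iy k))[_ /andP[]]]] := qa_mean_csm.
have AFb k : AF x <= b k.
  rewrite -(iter_mean_map_qa_mean k Ix).
  by have [_ [/(_ _ (Iy k))[_ /andP[]]]] := qa_mean_csm.
have IAF : I (AF x) by have [_ [/(_ _ Ix)[]]] := qa_mean_csm.
have a_cvg : cvgn a.
  by apply: nondecreasing_is_cvgn => //; exists (AF x) => _ [k _ <-].
have b_cvg : cvgn b.
  by apply: nonincreasing_is_cvgn => //; exists (AF x) => _ [k _ <-].
have a_lim := nondecreasing_cvgn_le a_nd a_cvg.
have b_lim := nonincreasing_cvgn_ge b_ni b_cvg.
have limaAF : limn a <= AF x by apply: limr_le => //; exact: nearW.
have AFlimb : AF x <= limn b by apply: limr_ge => //; exact: nearW.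
have Ia : I (limn a).
  by apply: (I_itv (min_row_in (Iy 0%N)) IAF); rewrite limaAF a_lim.
have Ib : I (limn b).
  by apply: (I_itv IAF (max_row_in (Iy 0%N))); rewrite AFlimb b_lim.
have limba : limn b <= limn a.
  rewrite leNgt; apply/negP => ab.
  by apply: (iter_mean_map_gap Ix Ia Ib ab) => k; split; [exact: a_lim|exact: b_lim].
have limaE : limn a = AF x by apply/le_anti; rewrite limaAF (le_trans AFlimb).
have limbE : limn b = AF x by apply/le_anti; rewrite AFlimb (le_trans limba).
apply/cvg_ballP => e e0.
have ea : \forall k \near \oo, AF x - e < a k.
  by apply: (cvgr_gt (limn a)) => //; rewrite limaE gtrBl.
have eb : \forall k \near \oo, b k < AF x + e.
  by apply: (cvgr_lt (limn b)) => //; rewrite limbE ltrDl.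
apply: filterS2 ea eb => k ak bk; split=> // i j; rewrite !ord1 mxE.
rewrite -ball_normE /= distrC ltr_distl; apply/andP; split.
  exact: lt_le_trans ak (min_row_le _ _).
exact: le_lt_trans (le_max_row _ _) bk.
Qed.

Lemma constant_sums_gauss_composition : is_gauss_composition I A AF.
Proof. by split; [exact: A_csm|exact: qa_mean_csm|exact: iter_mean_map_cvg]. Qed.

(** Both sides are the inverse of [F] at the average of all the
    [h i j (X i j)], summed by columns or by rows. *)
Lemma constant_sums_bisymmetry (X : 'M[R]_n.+1) :
  (forall i j, h i j = h j i) -> (forall i j, I (X i j)) ->
  AF (\row_j A j (col j X)^T) = AF (\row_i A i (row i X)).
Proof.
move=> hC IX; rewrite /AF /qa_mean; congr (inv_on I _ (_ / _)).
under eq_bigr => j _.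
  rewrite mxE generator_gqa_mean; last by move=> i; rewrite !mxE.
  under eq_bigr do rewrite hC !mxE.
  over.
rewrite exchange_big; apply: eq_bigr => i _.
rewrite mxE generator_gqa_mean; last by move=> j; rewrite !mxE.
by apply: eq_bigr => j _; rewrite !mxE.
Qed.

End ConstantSums.

(** * Uniqueness of the Gauss composition *)

(** Two Gauss compositions are limits of the same sequence of iterates. *)
Lemma gauss_composition_unique {R : realType} {n : nat} (I : set R)
    (M : 'I_n.+1 -> 'rV[R]_n.+1 -> R) (K : 'rV[R]_n.+1 -> R) :
  is_gauss_composition I M K ->
  forall x, cube I x -> gauss_composition I M x = K x.
Proof.
move=> MK x Ix; have [_ _ /(_ x Ix) Kx] := MK.
have [_ _ /(_ x Ix) Gx] : is_gauss_composition I M (gauss_composition I M).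
  by rewrite /gauss_composition; case: xgetP => [G _ //|/(_ K)].
have : const_mx (gauss_composition I M x) = const_mx (K x) :> 'rV[R]_n.+1.
  exact: (cvg_unique (@norm_hausdorff _ _) Gx Kx).
by move/rowP/(_ ord0); rewrite !mxE.
Qed.

(** * Cyclic shifts *)

Lemma ord_predE n (k : 'I_n.+2) : ord_pred k = k - 1.
Proof.
by apply: val_inj; rewrite /= modnDmr (@modn_small 1)// subn1 !addnS.
Qed.

(** As a translation of the cyclic group of indices, the iterate is injective
    in [k], so sums can be reindexed along it. *)
Lemma iter_ord_pred n i (k : 'I_n.+2) : iter i (@ord_pred n.+2) k = k - i%:R.
Proof.
elim: i => [|i /= ->]; first by rewrite subr0.
by rewrite ord_predE mulrSr opprD addrA.
Qed.

(** Permuting the variables amounts to permuting the generators the other way,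
    which leaves their sum unchanged. *)
Lemma cyc_mean_gqa {R : realType} {n : nat} (I : set R) (f : 'I_n.+2 -> R -> R)
    (i : 'I_n.+2) :
  cyc_mean (gqa_mean I f) i = gqa_mean I (fun j => f (j + i)).
Proof.
apply/funext => x; rewrite /cyc_mean /gqa_mean.
congr (inv_on I _ _).
  by apply/funext => t; rewrite /fun_sum (reindex_inj (addIr i)).
rewrite (reindex_inj (addIr i)); apply: eq_bigr => j _.
by rewrite mxE iter_ord_pred natr_Zp addrK.
Qed.

Theorem theorem4 (R : realType) (n : nat) (I : set R)
    (f : 'I_n.+2 -> R -> R)
    (I_itv : is_interval I)
    (I_nondeg : exists a b : R, [/\ I a, I b & a < b])
    (f_cont : forall i, {within I, continuous (f i)})
    (f_incr : forall i (s t : R), I s -> I t -> s < t -> f i s < f i t) :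
  let A (i : 'I_n.+2) : 'rV[R]_n.+2 -> R := cyc_mean (gqa_mean I f) i in
  let AF : 'rV[R]_n.+2 -> R := qa_mean I (fun_sum f) in
  [/\ is_gauss_composition I A AF,
      forall x : 'rV[R]_n.+2, cube I x -> gauss_composition I A x = AF x
    & forall X : 'M[R]_n.+2, (forall i j, I (X i j)) ->
        AF (\row_j A j (col j X)^T) = AF (\row_i A i (row i X))].
Proof.
move=> A AF.
(* This array is symmetric, and each row or column lists every [f k] once. *)
pose h (i j : 'I_n.+2) := f (j + i).
have AE : A = fun i => gqa_mean I (h i).
  by apply/funext => i; exact: cyc_mean_gqa.
have row_sum i : fun_sum (h i) = fun_sum f.
  by apply/funext => t; rewrite /fun_sum [RHS](reindex_inj (addIr i)).
have hC i j : h i j = h j i by rewrite /h addrC.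
have col_sum j : fun_sum (h^~ j) = fun_sum f.
  by rewrite -(row_sum j); congr fun_sum; apply/funext => i.
have h_cont i j : {within I, continuous (h i j)} by exact: f_cont.
have h_incr i j s t : I s -> I t -> s < t -> h i j s < h i j t.
  exact: f_incr.
have AAF : is_gauss_composition I A AF.
  by rewrite AE; exact: (constant_sums_gauss_composition I_itv h_cont h_incr).
split=> //; first exact: gauss_composition_unique.
move=> X IX; rewrite AE.
exact: (constant_sums_bisymmetry I_itv h_cont h_incr).
Qed.
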